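(* For every integer $d\geqslant 3$ there exist constants $c_d>0$, $\tau>0$ and $B_d>0$, depending only on $d$, such that for every finite metric space $\mathcal{M}=(M,\varrho)$ with $N:=|M|\geqslant 3$ points and every integer $n\geqslant d$ with $dn$ even, $$\mathbb{P}_{G(n,d)}\bigg[G\colon c_{\mathcal{M}}(G)\geqslant c_d\,\frac{\log n}{\min\{\log n,\log\log N\}}\bigg]\geqslant 1-\frac{B_d}{n^{\tau}},$$ where $c_{\mathcal{M}}(G)$ denotes the bi-Lipschitz distortion of $(G,\mathrm{dist}_G)$ into $\mathcal{M}$.
   Context: $G(n,d)$ denotes the set of all $d$-regular (simple) graphs on $[n]:=\{1,\dots,n\}$ and $\mathbb{P}_{G(n,d)}$ the uniform probability measure on $G(n,d)$; statements about $\mathbb{P}_{G(n,d)}$ are understood for those $n$ for which $G(n,d)\neq\emptyset$. $\log$ is the natural logarithm. For a graph $G$, $\mathrm{dist}_G$ is the shortest-path distance on its vertex set $V_G$, with the convention $\mathrm{dist}_G(v,u):=|V_G|$ if $v,u$ lie in different connected components. For metric spaces $\mathcal{M}_1=(M_1,\varrho_1)$ and $\mathcal{M}_2=(M_2,\varrho_2)$, the (bi-Lipschitz) distortion $c_{\mathcal{M}_2}(\mathcal{M}_1)$ of $\mathcal{M}_1$ into $\mathcal{M}_2$ is the smallest constant $D>0$ for which there exist a map $f\colon M_1\to M_2$ and a scaling factor $s>0$ with $s\,\varrho_1(i,j)\leqslant\varrho_2(f(i),f(j))\leqslant sD\,\varrho_1(i,j)$ for all $i,j\in M_1$ (and $c_{\mathcal{M}_2}(\mathcal{M}_1)=\infty$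 if there is no such $D$). *)

(* Defs.v *)
From HB Require Import structures.
From mathcomp Require Import all_boot all_order all_algebra.
From mathcomp Require Import all_classical all_reals all_analysis.
Set Implicit Arguments.
Unset Strict Implicit.
Unset Printing Implicit Defensive.
Import Order.TTheory GRing.Theory Num.Theory.
Local Open Scope ring_scope.

Section Graphs.
Variable V : finType.
Implicit Types (E : {set {set V}}) (u v : V).

(* A graph on V is given by its set of edges, which are 2-element subsets
   of V.  In particular adj E is symmetric, and irreflexive when E is simple. *)
Definition simple E : bool := [forall e in E, #|e| == 2].

Definition adj E : rel V := fun u v => [set u; v]%SET \in E.

Definition regular (d : nat) E : bool :=
  [forall v, #|[set u | adj E v u]%SET| == d].

Definition walk E (k : nat) u v : bool :=
  [exists p : k.-tuple V, path (adj E) u p && (last u p == v)].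

(* Shortest paths have fewer than #|V| edges, so bounding k loses nothing;
   the minimum over the empty family is #|V|, which is the value
   prescribed when u and v lie in different components. *)
Definition gdist E u v : nat :=
  \big[minn/#|V|]_(k < #|V| | walk E k u v) k.

End Graphs.

Definition Gnd (n d : nat) : {set {set {set 'I_n}}} :=
  [set E | simple E && regular d E]%SET.

Definition prob_Gnd (R : realType) (n d : nat) (A : set {set {set 'I_n}}) : R :=
  #|[set E in Gnd n d | `[< A E >]]%SET|%:R / #|Gnd n d|%:R.

(* The infimum is +oo when no D is admissible. *)
Definition distortion (R : realType) (T1 T2 : Type)
    (rho1 : T1 -> T1 -> R) (rho2 : T2 -> T2 -> R) : \bar R :=
  ereal_inf [set D%:E | D in [set D : R | 0 < D /\
    exists (f : T1 -> T2) (s : R), 0 < s /\ forall i j,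
      s * rho1 i j <= rho2 (f i) (f j) <= s * D * rho1 i j]]%classic.

Definition graph_distortion (R : realType) (n : nat) (E : {set {set 'I_n}})
    (M : metricType R) : \bar R :=
  distortion (fun u v => (gdist E u v)%:R) (@mdist R M).

(* Main.v *)
Require Import Defs.
From mathcomp Require Import all_boot all_order all_algebra all_fingroup zify.
Set Implicit Arguments.
Unset Strict Implicit.
Unset Printing Implicit Defensive.

(** The proof is a counting argument. Let [t] be of order [ln (ln N)], so that a
    [t]-ball that grows has at least [A >= log_2 N] points. In any graph, a maximal
    [t]-separated family of centres of large [t]-balls is a net of at most [n / A]
    points; the vertices not close to this net have small balls, and ball growing
    splits them into clusters of radius [t], at the cost of deleting few vertices.

    If [f] embeds the graph into [M] with distortion [D], every edge between vertices
    close to the net joins vertices whose net points have images at distance at most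
    a common threshold, and, [f] being an embedding, each vertex has only
    [n ^ epsilon] partners of this kind when [D < c ln n / ln (ln N)]. Hence such a
    graph is determined by the partition ([n ^ n] choices), by [f] on the net
    ([N ^ (n / A) <= 2 ^ n] choices) and by [n ^ (epsilon n)] further choices.
    On the other hand, lifts of [K_(d, d)] already provide [n ^ (d n / 2)] regular
    graphs up to factors exponential in [n], and [d / 2 >= 3 / 2 > 1]. *)

(** * Balls and clusters *)

Lemma leq_card_bigcup (I T : finType) (P : pred I) (F : I -> {set T}) :
  #|\bigcup_(i | P i) F i| <= \sum_(i | P i) #|F i|.
Proof.
elim/big_ind2: _ => [|A a B b hA hB|//]; first by rewrite cards0.
by rewrite cardsU (leq_trans (leq_subr _ _)) // leq_add.
Qed.

Section Balls.
Variable V : finType.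
Implicit Types (e : rel V) (A R S X : {set V}) (u v w : V) (k l : nat).

Definition nbhd e A : {set V} := A :|: [set w | [exists v in A, e v w]].

Definition gball e k v : {set V} := iter k (nbhd e) [set v].

Lemma sub_nbhd e A : A \subset nbhd e A.
Proof. exact: subsetUl. Qed.

Lemma nbhd_edge e A v w : v \in A -> e v w -> w \in nbhd e A.
Proof.
by move=> vA evw; rewrite !inE; apply/orP; right; apply/existsP; exists v; rewrite vA.
Qed.

Lemma nbhdP e A w :
  reflect (w \in A \/ exists2 v, v \in A & e v w) (w \in nbhd e A).
Proof.
rewrite !inE; apply: (iffP orP) => -[wA|]; try by left.
  by case/existsP=> v /andP[vA evw]; right; exists v.
by case=> v vA evw; right; apply/existsP; exists v; rewrite vA.
Qed.

Lemma gballS e k v : gball e k.+1 v = nbhd e (gball e k v).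
Proof. by []. Qed.

Lemma gball_center e k v : v \in gball e k v.
Proof.
by elim: k => [|k IH]; [rewrite inE | rewrite gballS (subsetP (sub_nbhd _ _))].
Qed.

Lemma leq_gball e k l v : k <= l -> gball e k v \subset gball e l v.
Proof.
move=> /subnK <-; elim: (l - k) => [|j IH] //.
by rewrite addSn gballS (subset_trans IH) ?sub_nbhd.
Qed.

Lemma gball_trans e k l u v w :
  v \in gball e k u -> w \in gball e l v -> w \in gball e (k + l) u.
Proof.
move=> vu; elim: l w => [|l IH] w; first by rewrite inE addn0 => /eqP->.
rewrite addnS !gballS => /nbhdP[/IH/(subsetP (sub_nbhd _ _))//|[x /IH xu exw]].
exact: nbhd_edge xu exw.
Qed.

Lemma gball1 e u v : e u v -> v \in gball e 1 u.
Proof. by move=> euv; apply: nbhd_edge euv; rewrite inE. Qed.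

Lemma gball_sym e k u v : symmetric e -> v \in gball e k u -> u \in gball e k v.
Proof.
move=> es; elim: k v => [|k IH] v; first by rewrite !inE eq_sym.
rewrite gballS => /nbhdP[/IH uB|[x /IH ux exv]].
  exact: (subsetP (sub_nbhd _ _)).
by rewrite -add1n; apply: gball_trans ux; apply: gball1; rewrite es.
Qed.

Lemma gball_subrel e e' k v : subrel e e' -> gball e k v \subset gball e' k v.
Proof.
move=> ee'; elim: k => [|k IH] //; apply/subsetP => w.
rewrite !gballS => /nbhdP[/(subsetP IH)/(subsetP (sub_nbhd _ _))//|[x]].
by move=> /(subsetP IH) xB /ee'; apply: nbhd_edge.
Qed.

Lemma card_gball e d k v :
  (forall u, #|[set w | e u w]| <= d) -> #|gball e k v| <= d.+1 ^ k.
Proof.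
move=> deg; elim: k => [|k IH]; first by rewrite cards1.
rewrite gballS expnS; apply: leq_trans (leq_mul (leqnn _) IH).
rewrite mulSn; rewrite cardsU; apply: leq_trans (leq_subr _ _) _; rewrite leq_add2l.
have /subset_leq_card/leq_trans -> // : [set w | [exists x in gball e k v, e x w]]
    \subset \bigcup_(x in gball e k v) [set w | e x w].
  apply/subsetP => w; rewrite inE => /existsP[x /andP[xB exw]].
  by apply/bigcupP; exists x; rewrite ?inE.
apply: leq_trans (leq_card_bigcup _ _) _.
by rewrite mulnC -sum_nat_const; apply: leq_sum.
Qed.

Definition induced e R : rel V := fun u v => [&& u \in R, v \in R & e u v].

Lemma induced_sub e R : subrel (induced e R) e.
Proof. by move=> u v /and3P[]. Qed.

Lemma inducedS e R S : R \subset S -> subrel (induced e R) (induced e S).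
Proof. by move=> /subsetP RS u v /and3P[/RS uS /RS vS euv]; apply/and3P. Qed.

Lemma gball_induced e R k v : v \in R -> gball (induced e R) k v \subset R.
Proof.
move=> vR; elim: k => [|k IH]; first by rewrite sub1set.
apply/subsetP => w; rewrite gballS => /nbhdP[/(subsetP IH)//|[x _ /and3P[]//]].
Qed.

(** The integer form of [(1 + 1/q)^q >= 2]: keep the first two terms of the binomial expansion. *)
Lemma expn_succ_ge q : 0 < q -> 2 * q ^ q <= q.+1 ^ q.
Proof.
case: q => [//|q _].
rewrite -[q.+2]addn1 expnDn big_ord_recl big_ord_recl /= !exp1n !muln1 bin0 mul1n.
by rewrite subn0 bin1 /bump /= subSS subn0 -expnS addnA mul2n -addnn leq_addr.
Qed.

(** Otherwise every step multiplies [b] by more than [1 + 1/q], and [q * a] such steps multiply it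
    by at least [2 ^ a]. A step where [b] decreases is slow as well, its truncated difference being
    0. *)
Lemma slow_growth (b : nat -> nat) q a :
  0 < q -> b 0 = 1 -> b (q * a) < 2 ^ a ->
  exists2 j, j < q * a & q * (b j.+1 - b j) <= b j.
Proof.
move=> q0 b0 blt.
suff : [exists j : 'I_(q * a), q * (b j.+1 - b j) <= b j].
  by case/existsP=> j hj; exists j.
apply/contraT; rewrite negb_exists => /forallP fast.
have grow j : j <= q * a -> q.+1 ^ j <= q ^ j * b j.
  elim: j => [|j IH] jt; first by rewrite b0.
  have := fast (Ordinal jt); rewrite -ltnNge /= => hj.
  have : q.+1 * b j <= q * b j.+1.
    rewrite mulSn; have := ltnW hj; rewrite mulnBr => h.
    case/orP: (leq_total (q * b j.+1) (q * b j)) => h'.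
      by move: hj; rewrite mulnBr; move/eqP: h' => ->.
    by rewrite -(leq_add2r (q * b j)) subnK // in h.
  move=> h; rewrite expnS expnSr -mulnA.
  apply: leq_trans (leq_mul (leqnn q.+1) (IH (ltnW jt))) _.
  by rewrite mulnCA leq_mul2l h orbT.
case: a => [|a] in blt fast grow *; first by rewrite muln0 b0 in blt.
have : q ^ (q * a.+1) * 2 ^ a.+1 <= q ^ (q * a.+1) * b (q * a.+1).
  apply: leq_trans (grow _ (leqnn _)).
  by rewrite !expnM mulnC -expnMn leq_exp2r ?expn_succ_ge.
by rewrite leq_pmul2l ?expn_gt0 ?q0 // leqNgt blt.
Qed.

End Balls.
Section Decomposition.
Variables (V : finType) (e : rel V).
Hypothesis e_sym : symmetric e.

(* Ball growing: a ball that stays small has a thin outer layer; cut it off along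
   that layer, which goes into [X], and recurse on the rest of [R]. *)
Lemma clustering q a (R : {set V}) :
    0 < q -> (forall v, v \in R -> #|gball (induced e R) (q * a) v| < 2 ^ a) ->
  exists (c : V -> V) (X : {set V}),
    [/\ q * #|X| <= #|R|,
        forall u, u \in R -> u \in gball e (q * a) (c u) &
        forall u v, u \in R -> v \in R -> e u v -> u \notin X -> v \notin X ->
          c u = c v].
Proof.
move=> q0; have [k] := ubnP #|R|; elim: k R => // k IH R ltRk small.
have [->|[v vR]] := set_0Vmem R.
  by exists id, set0; split=> [|u|u w]; rewrite ?cards0 ?muln0 ?inE.
have [j jt thin] :=
  @slow_growth (fun j => #|gball (induced e R) j v|) q a q0 (cards1 v) (small v vR).
set C := gball (induced e R) j v; set C' := gball (induced e R) j.+1 v.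
have CR : C \subset R by apply: gball_induced.
have vC : v \in C by apply: gball_center.
have [|u|c [X [cX cc ce]]] := IH (R :\: C).
- rewrite -ltnS; apply: leq_trans ltRk; rewrite ltnS; apply: proper_card.
  by apply/properP; split; [apply: subsetDl | exists v; rewrite // !inE vC].
- rewrite inE => /andP[_ uR]; apply: leq_ltn_trans (small u uR).
  by apply/subset_leq_card/gball_subrel/inducedS/subsetDl.
exists (fun u => if u \in C then v else c u), (X :|: (C' :\: C)); split.
(* Each layer is charged to the ball [C] that it surrounds; the balls cut off are disjoint, so the
   layers total at most a fraction [1/q] of [R]. *)
- have layer : #|C' :\: C| = #|C'| - #|C|.
    by rewrite cardsD (setIidPr (leq_gball _ _ (leqnSn j))).
  rewrite cardsU; apply: leq_trans (leq_mul (leqnn q) (leq_subr _ _)) _.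
  rewrite mulnDr layer; apply: leq_trans (leq_add cX thin) _.
  by rewrite cardsD (setIidPr CR) subnK // subset_leq_card.
- move=> u uR; case: ifP => uC; last by apply: cc; rewrite inE uC.
  apply: subsetP uC; apply: subset_trans (leq_gball _ _ (ltnW jt)).
  exact/gball_subrel/induced_sub.
have out u w : u \in C -> w \in R -> e u w -> w \notin X :|: (C' :\: C) -> w \in C.
  move=> uC wR euw; rewrite in_setU in_setD negb_or negb_and negbK => /andP[_ /orP[//|]].
  by move=> /negP[]; apply: (nbhd_edge uC); rewrite /induced (subsetP CR _ uC) wR.
move=> u w uR wR euw uX wX; case: ifP => uC; case: ifP => wC //.
- by rewrite (out u w) in wC.
- by rewrite (out w u) // e_sym in uC.
- apply: ce => //; rewrite ?inE ?uC ?wC //.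
  + by move: uX; rewrite inE; case/norP.
  + by move: wX; rewrite inE; case/norP.
Qed.

(** Take [S] maximal in [G] with disjoint [t]-balls, disjointness being stated as no vertex lying in
    two of them. Double counting bounds [#|S|]; by maximality the [t]-ball of any other [u] in [G]
    meets that of some [s], which gives radius [t + t]. *)
Lemma separated_net t A (G : {set V}) :
    (forall v, v \in G -> A <= #|gball e t v|) ->
  exists S : {set V}, #|S| * A <= #|V| /\
    forall u, u \in G -> exists2 s, s \in S & u \in gball e (t + t) s.
Proof.
move=> big.
pose P (S : {set V}) :=
  (S \subset G) && [forall v, #|[set x in S | v \in gball e t x]| <= 1].
have P0 : P set0.
  rewrite /P sub0set; apply/forallP => v; rewrite (_ : [set x in _ | _] = set0).
    by rewrite cards0.
  by apply/setP => x; rewrite !inE.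
have [S /maxsetP[/andP[SG /forallP disj] maxS] _] := maxset_exists P0.
exists S; split.
  apply: (@leq_trans (\sum_(x in S) #|gball e t x|)).
    by rewrite -sum_nat_const leq_sum // => x /(subsetP SG)/big.
  rewrite (eq_bigr (fun x => \sum_(v in V) (v \in gball e t x))); last first.
    by move=> x _; rewrite -sum1_card big_mkcond /=; apply: eq_bigr => v; case: ifP.
  rewrite exchange_big /= -sum1_card leq_sum // => v _; apply: leq_trans (disj v).
  rewrite -sum1_card [leqRHS]big_mkcond [leqLHS]big_mkcond leq_sum // => x _.
  by rewrite inE; case: (x \in S); case: (v \in _).
move=> u uG; have [uS|uS] := boolP (u \in S).
  by exists u; rewrite ?gball_center.
have : ~~ P (u |: S).
  apply: contra uS => Pu; have -> : S = u |: S by rewrite (maxS _ Pu) ?subsetUr.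
  by rewrite !inE eqxx.
rewrite /P subUset sub1set uG SG /= negb_forall => /existsP[v].
rewrite -ltnNge => /card_gt1P[x [y [+ + xy]]].
have meet s : s \in S -> v \in gball e t s -> v \in gball e t u ->
    exists2 s, s \in S & u \in gball e (t + t) s.
  by move=> sS vs vu; exists s => //; apply: gball_trans vs (gball_sym e_sym vu).
rewrite !inE => /andP[/orP[/eqP xu|xS] vx] /andP[/orP[/eqP yu|yS] vy].
- by rewrite xu yu eqxx in xy.
- by rewrite xu in vx; apply: meet yS vy vx.
- by rewrite yu in vy; apply: meet xS vx vy.
- have := disj v; rewrite leqNgt; case/negP; apply/card_gt1P.
  by exists x, y; rewrite !inE xS yS vx vy.
Qed.

(* [inl]: close to one of the few net points [g b]; [inr]: in a cluster centred at a vertex. *)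
Definition same_part m (x y : 'I_m + V) : bool :=
  match x, y with
  | inl _, inl _ => true
  | inr x, inr y => x == y
  | _, _ => false
  end.

(** The vertices with large [t]-balls are near a net, and the others are clustered. Clusters
    adjacent to the first kind join the net part, so that outside [X] no edge runs between the two
    parts. *)
Lemma decomposition q a (v0 : V) : 0 < q ->
  let t := q * a in let m := #|V| %/ 2 ^ a in
  exists (g : 'I_m.+1 -> V) (p : V -> 'I_m.+1 + V) (X : {set V}),
    [/\ q * #|X| <= #|V|,
        forall u b, p u = inl b -> u \in gball e (4 * t + 1) (g b),
        forall u x, p u = inr x -> u \in gball e t x &
        forall u v, e u v -> u \notin X -> v \notin X -> same_part (p u) (p v)].
Proof.
move=> q0 t m; set A := 2 ^ a.
pose G := [set v | A <= #|gball e t v|].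
have [S [cardS netS]] : exists S : {set V}, #|S| * A <= #|V| /\
    forall u, u \in G -> exists2 s, s \in S & u \in gball e (t + t) s.
  by apply: separated_net => v; rewrite inE.
have [|c [X [cX cc ce]]] := @clustering q a (~: G) q0.
  move=> v; rewrite !inE -ltnNge; apply: leq_ltn_trans.
  exact/subset_leq_card/gball_subrel/induced_sub.
(* A cluster is handed to the net as a whole as soon as one of its vertices has a neighbour in
   [G]. *)
pose touch u := [exists w in ~: G, exists x in G, (c w == c u) && e w x].
pose cov u := (u \in G) || touch u.
have covP u : cov u -> exists2 s, s \in S & u \in gball e (4 * t + 1) s.
  have [uG _|uG] := boolP (u \in G).
    have [s sS us] := netS u uG; exists s => //.
    by apply: subsetP us; apply: leq_gball; lia.
  rewrite /cov (negPf uG) /= => /existsP[w /andP[wG /existsP[x /and3P[xG /eqP cw ewx]]]].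
  have [s sS xs] := netS x xG; exists s => //.
  (* The route is [s] to [x] ([t + t]), the edge to [w] (1), the cluster centre ([t]), then [u]
     ([t]). *)
  have -> : 4 * t + 1 = t + t + 1 + t + t by lia.
  apply: gball_trans (cc u _); last by rewrite inE.
  apply: gball_trans (gball_sym e_sym _); last by rewrite -cw; apply: cc.
  by apply: gball_trans xs _; apply: gball1; rewrite e_sym.
pose near u := [pick s in S | u \in gball e (4 * t + 1) s].
(* [S] has at most [m] points, so [inord] keeps the index of a net point. The default [v0] only
   serves at vertices without a near net point and, in [nth] below, at indices beyond [S]. *)
pose idx u : 'I_m.+1 := inord (index (odflt v0 (near u)) (enum S)).
exists (fun b => nth v0 (enum S) b), (fun u => if cov u then inl (idx u) else inr (c u)), X.
split.
- by apply: leq_trans cX _; apply: max_card.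
- move=> u b; case: ifP => // /covP cu [<-]; rewrite /idx /near.
  case: pickP => [s /andP[sS us] | none]; last first.
    by case: cu => s sS us; have := none s; rewrite sS us.
  rewrite inordK; first by rewrite nth_index ?mem_enum.
  rewrite ltnS leq_divRL ?expn_gt0 //; apply: leq_trans cardS.
  by rewrite leq_mul2r cardE ltnW ?orbT // index_mem mem_enum.
- move=> u x; case: ifP => // /negbT/norP[uG _] [<-]; apply: cc.
  by rewrite inE.
(* From a vertex of [G], an edge makes its other end touch [G]; between two vertices outside [G],
   the clusters agree and [touch] depends only on the cluster. *)
have step u v : e u v -> u \notin X -> v \notin X -> cov u -> cov v.
  move=> euv uX vX cu; rewrite /cov; have [//|vG] := boolP (v \in G).
  have [uG|uG] := boolP (u \in G).
    apply/existsP; exists v; rewrite inE vG; apply/existsP; exists u.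
    by rewrite uG eqxx e_sym.
  move: cu; rewrite /cov (negPf uG) /= /touch.
  by rewrite (ce u v) // inE.
move=> u v euv uX vX; case: ifP => cu.
  by rewrite (step u v).
case: ifP => cv; first by rewrite e_sym in euv; rewrite (step v u) in cu.
apply/eqP/ce => //; rewrite inE.
- by case/norP: (negbT cu).
- by case/norP: (negbT cv).
Qed.

End Decomposition.

(** * Graphs captured by few data *)

(** Such a set arises from [d] successive choices, each of a point of [H] or of nothing. *)
Lemma card_small_subsets (T : finType) (H : {set T}) d :
  #|[set A : {set T} | (A \subset H) && (#|A| <= d)]| <= #|H|.+1 ^ d.
Proof.
elim: d => [|d IH].
  apply: leq_trans (_ : #|[set (set0 : {set T})]| <= 1); last by rewrite cards1.
  apply/subset_leq_card/subsetP => A; rewrite !inE leqn0 cards_eq0.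
  by case/andP.
set F := [set A : {set T} | _] in IH.
have /subset_leq_card/leq_trans -> // :
    [set A : {set T} | (A \subset H) && (#|A| <= d.+1)] \subset
    F :|: \bigcup_(x in H) [set x |: B | B in F].
  apply/subsetP => A; rewrite inE => /andP[AH cA]; rewrite inE.
  have [cA'|cA'] := leqP #|A| d; first by rewrite inE AH cA'.
  have [x xA] : exists x, x \in A by apply/card_gt0P; apply: leq_trans cA'.
  apply/orP; right; apply/bigcupP; exists x; first exact: (subsetP AH).
  apply/imsetP; exists (A :\ x); last by rewrite setD1K.
  rewrite inE (subset_trans (subD1set _ _) AH) /= -ltnS.
  by move: cA; rewrite (cardsD1 x) xA.
rewrite cardsU; apply: leq_trans (leq_subr _ _) _.
rewrite expnS mulSn leq_add //; apply: leq_trans (leq_card_bigcup _ _) _.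
apply: leq_trans (leq_mul (leqnn #|H|) IH).
by rewrite -sum_nat_const leq_sum // => x _; apply: leq_imset_card.
Qed.

Section GraphCount.
Variable V : finType.
Implicit Types (E : {set {set V}}) (X : {set V}) (u v : V).

Lemma adj_sym E : symmetric (adj E).
Proof. by move=> u v; rewrite /adj setUC. Qed.

Lemma simple_adj_inj E E' : simple E -> simple E' -> adj E =2 adj E' -> E = E'.
Proof.
move=> /forall_inP sE /forall_inP sE' EE'; apply/setP => a.
have [ca|ca] := boolP (#|a| == 2).
  by have /cards2P[u [v [_ ->]]] := ca; apply: EE'.
have notin (F : {set {set V}}) : {in F, forall e : {set V}, #|e| == 2} -> (a \in F) = false.
  by move=> sF; apply: contraNF ca => /sF.
by rewrite (notin _ sE) (notin _ sE').
Qed.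

(** A graph is encoded by its neighbourhoods, with [X] removed from those of vertices outside [X]:
    an edge meeting [X] is still read off at its end in [X]. Away from [X] a neighbourhood is then a
    choice of at most [d] among [D] vertices. *)
Lemma card_graphs_near d X (H : rel V) D :
    (forall u, #|[set v | H u v]| <= D) ->
  #|[set E | [&& simple E, regular d E &
       [forall u, forall v, adj E u v ==> [|| u \in X, v \in X | H u v]]]]|
    <= D.+1 ^ (d * #|V|) * #|V|.+1 ^ (d * #|X|).
Proof.
move=> degH; set B := [set E | _].
pose N E u := [set v | adj E u v].
pose Phi E := [ffun u => if u \in X then N E u else N E u :\: X].
pose F u := [set A : {set V} |
  (A \subset (if u \in X then [set: V] else [set v | H u v])) && (#|A| <= d)].
have Phi_inj : {in B &, injective Phi}.
  move=> E E'; rewrite !inE => /and3P[sE _ _] /and3P[sE' _ _] /ffunP EE'.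
  have X_adj u v : u \in X -> adj E u v = adj E' u v.
    by move=> uX; have /setP/(_ v) := EE' u; rewrite !ffunE uX !inE.
  apply: simple_adj_inj => // u v.
  have [uX|uX] := boolP (u \in X); first exact: X_adj.
  have [vX|vX] := boolP (v \in X).
    by rewrite adj_sym X_adj // adj_sym.
  by have /setP/(_ v) := EE' u; rewrite !ffunE (negPf uX) !inE vX.
rewrite -(card_in_imset Phi_inj).
apply: leq_trans (_ : #|(family F : {pred {ffun V -> {set V}}})| <= _).
  apply/subset_leq_card/subsetP => _ /imsetP[E + ->].
  rewrite inE => /and3P[_ /forallP rE /forallP hE].
  apply/familyP => u; rewrite ffunE inE.
  have /eqP degE := rE u.
  case: ifP => uX; first by rewrite subsetT /N degE leqnn.
  rewrite (leq_trans (subset_leq_card (subsetDl _ _))) ?degE ?leqnn // andbT.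
  apply/subsetP => v; rewrite !inE => /andP[vX uv].
  by have /forallP/(_ v) := hE u; rewrite uv uX (negPf vX).
rewrite card_family foldrE big_map /=.
apply: (@leq_trans (\prod_(u : V) (D.+1 ^ d * (if u \in X then #|V|.+1 ^ d else 1)))).
  rewrite big_enum /=; elim/big_ind2: _ => // [x x' y y'|u _]; first exact: leq_mul.
  apply: leq_trans (card_small_subsets _ _) _.
  case: ifP => uX; first by rewrite cardsT leq_pmull // expn_gt0.
  by rewrite muln1; case: (d) => [|d0]; rewrite ?expn0 // leq_exp2r // ltnS.
rewrite big_split /= -big_mkcond /= !prod_nat_const -!expnM leq_mul //.
Qed.

End GraphCount.

Section FewGraphs.
Variables (V T I : finType) (Q : I -> rel T).

(* A graph captured by [Q i] through [f] is encoded, up to the edges at few vertices, by its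
   decomposition and the values of [f] at the net points alone. *)
Definition captured r k E (f : V -> T) i :=
  (forall u v, v \in gball (adj E) r u -> Q i (f u) (f v)) /\
  (forall u v, Q i (f u) (f v) -> v \in gball (adj E) k u).

Lemma card_captured d q a k (B : {set {set {set V}}}) :
    0 < q -> 0 < #|V| ->
    let t := q * a in let r := 4 * t + 1 in let m := #|V| %/ 2 ^ a in
    (forall E, E \in B -> [/\ simple E, regular d E &
       exists (f : V -> T) (i : I), captured (r + r + 1) k E f i]) ->
  #|B| <= (m.+1 + #|V|) ^ #|V| * #|T| ^ m.+1 * #|I| * 2 ^ #|V| *
    ((d.+1 ^ (r + r + k)).+1 ^ (d * #|V|) * #|V|.+1 ^ (d * (#|V| %/ q))).
Proof.
move=> q0 V0 t r m hB.
have [v0 _] : exists v0, v0 \in [set: V] by apply/card_gt0P; rewrite cardsT.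
set D := d.+1 ^ (r + r + k).
(* The components are the partition, the images of the net points, the index of the threshold and
   the exceptional set. *)
pose code : finType := ({ffun V -> 'I_m.+1 + V} * {ffun 'I_m.+1 -> T} * I * {set V})%type.
pose H (c : code) u v :=
  let: (p, h, i, X) := c in
  match p u, p v with
  | inl b, inl b' => Q i (h b) (h b')
  | inr x, inr y => x == y
  | _, _ => false
  end.
pose good (c : code) := [forall u, #|[set v | H c u v]| <= D] && (q * #|c.2| <= #|V|).
pose G (c : code) := [set E | [&& simple E, regular d E &
  [forall u, forall v, adj E u v ==> [|| u \in c.2, v \in c.2 | H c u v]]]].
have BG : B \subset \bigcup_(c | good c) G c.
  apply/subsetP => E /hB[sE rE [f [i [fQ Qf]]]].
  have degE u : #|[set v | adj E u v]| <= d by have /forallP/(_ u)/eqP-> := rE.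
  have [g [p [X [cX pl pr pe]]]] := decomposition (@adj_sym _ E) a v0 q0.
  rewrite -/t -/m in g p pl pr pe.
  pose c : code := ([ffun u => p u], [ffun b => f (g b)], i, X).
  apply/bigcupP; exists c.
    rewrite /good /= cX andbT; apply/forallP => u.
    (* All [H]-partners of [u] lie in one ball: they are reached through two net points in
       [r + k + r] steps, or through a common cluster centre in [t + t]. *)
    apply: leq_trans (card_gball (r + r + k) u degE).
    apply/subset_leq_card/subsetP => v; rewrite inE /H /= !ffunE.
    case pu: (p u) => [b|x]; case pv: (p v) => [b'|y] //.
      rewrite !ffunE => /Qf gg'; have -> : r + r + k = r + k + r by lia.
      apply: gball_trans (pl v b' pv); apply: gball_trans gg'.
      exact/(gball_sym (@adj_sym _ E))/pl.
    move/eqP => xy; subst y.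
    have : v \in gball (adj E) (t + t) u.
      by apply: gball_trans (pr v x pv); apply/(gball_sym (@adj_sym _ E))/pr.
    by apply: subsetP; apply: leq_gball; rewrite /r; lia.
  rewrite inE sE rE; apply/forallP => u; apply/forallP => v; apply/implyP => uv /=.
  case uX: (u \in X) => //=; case vX: (v \in X) => //=.
  have := pe u v uv (negbT uX) (negbT vX); rewrite !ffunE.
  case pu: (p u) => [b|x]; case pv: (p v) => [b'|y] // _.
  rewrite !ffunE; apply: fQ.
  (* The net points of two adjacent vertices are this close, which is the radius imposed in
     [captured]. *)
  have -> : r + r + 1 = r + 1 + r by lia.
  apply: gball_trans (gball_sym (@adj_sym _ E) (pl v b' pv)).
  by apply: gball_trans (gball1 uv); apply: pl.
apply: leq_trans (subset_leq_card BG) _; apply: leq_trans (leq_card_bigcup _ _) _.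
have -> : (m.+1 + #|V|) ^ #|V| * #|T| ^ m.+1 * #|I| * 2 ^ #|V| = #|code|.
  rewrite !card_prod !card_ffun card_sum !card_ord -(cardsT {set V}) -powersetT.
  by rewrite card_powerset cardsT.
rewrite -sum_nat_const [leqRHS](bigID good) /=.
apply: leq_trans (leq_addr _ _); apply: leq_sum => c /andP[/forallP degH cX].
apply: leq_trans (card_graphs_near _ _ degH) _; rewrite leq_mul2l; apply/orP; right.
by rewrite leq_exp2l // leq_mul2l leq_divRL // mulnC cX orbT.
Qed.

End FewGraphs.

(** * Many regular graphs *)

Section ManyGraphs.

Definition graph_of (V : finType) (e : rel V) : {set {set V}} :=
  [set [set x.1; x.2] | x in [set x : V * V | e x.1 x.2]].

Lemma adj_graph_of (V : finType) (e : rel V) : symmetric e -> adj (graph_of e) =2 e.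
Proof.
move=> es u v; apply/imsetP/idP => [[[x y]]|euv]; last by exists (u, v); rewrite ?inE.
rewrite inE /= => exy uv.
have hu : (u == x) || (u == y) by have := set21 u v; rewrite uv !inE.
have hv : (v == x) || (v == y) by have := set22 u v; rewrite uv !inE.
have hx : (x == u) || (x == v) by have := set21 x y; rewrite -uv !inE.
have hy : (y == u) || (y == v) by have := set22 x y; rewrite -uv !inE.
case/orP: hu hx hy => /eqP->; case/orP: hv => /eqP->; rewrite ?orbb // 1?es //.
  by move=> _ /eqP yx; rewrite yx in exy.
by move=> /eqP xy _; rewrite xy in exy.
Qed.

Lemma simple_graph_of (V : finType) (e : rel V) : irreflexive e -> simple (graph_of e).
Proof.
move=> ei; apply/forall_inP => a /imsetP[[x y] + ->]; rewrite inE /= => exy.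
by rewrite cards2; case: (x =P y) exy => [->|//]; rewrite ei.
Qed.

(** This transports a family of regular relations on any finite type to graphs on ordinals, so that
    constructions may use convenient vertex types. *)
Lemma leq_card_Gnd (W J : finType) (e : J -> rel W) d :
    (forall j, symmetric (e j)) -> (forall j, irreflexive (e j)) ->
    (forall j w, #|[set x | e j w x]| = d) ->
    (forall j j', e j =2 e j' -> j = j') ->
  #|J| <= #|Gnd #|W| d|.
Proof.
move=> es ei deg inj.
pose e' j : rel 'I_#|W| := fun u v => e j (enum_val u) (enum_val v).
have e's j : symmetric (e' j) by move=> u v; apply: es.
have ginj : injective (fun j => graph_of (e' j)).
  move=> j j' jj'; apply: inj => x y.
  have := adj_graph_of (e's j) (enum_rank x) (enum_rank y).
  by rewrite jj' adj_graph_of // /e' !enum_rankK.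
rewrite -[#|J|](card_imset _ ginj); apply/subset_leq_card/subsetP => _ /imsetP[j _ ->].
rewrite inE simple_graph_of /=; last by move=> u; apply: ei.
apply/forallP => u; apply/eqP; rewrite -(deg j (enum_val u)).
rewrite -(card_imset _ enum_val_inj); congr #|pred_of_set _|; apply/setP => x.
rewrite inE; apply/imsetP/idP => [[v + ->]|jux].
  by rewrite inE adj_graph_of.
by exists (enum_rank x); rewrite ?enum_rankK // inE adj_graph_of // /e' enum_rankK.
Qed.

(* Disjoint union of a fixed graph and a [k]-fold lift of the complete bipartite graph
   [K_(d, d)]; the permutations [s] that define the lift can be read off the graph. *)
Definition lift_rel r d k (e : rel 'I_r) (s : {ffun 'I_d * 'I_d -> {perm 'I_k}}) :
    rel ('I_r + bool * ('I_d * 'I_k)) := fun w w' =>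
  match w, w' with
  | inl u, inl v => e u v
  | inr (true, (i, x)), inr (false, (j, y)) => s (i, j) x == y
  | inr (false, (j, y)), inr (true, (i, x)) => s (i, j) x == y
  | _, _ => false
  end.

(** In the lift, a vertex has exactly one neighbour in each of the [d] fibres of the opposite side.
    The fixed graph on [r] vertices adjusts the number of vertices modulo [2 * d]. *)
Lemma card_Gnd_lift r d k : 0 < #|Gnd r d| -> k`! ^ (d * d) <= #|Gnd (r + 2 * (d * k)) d|.
Proof.
case/card_gt0P => E; rewrite inE => /andP[sE /forallP rE].
have -> : k`! ^ (d * d) = #|{ffun 'I_d * 'I_d -> {perm 'I_k}}|.
  by rewrite card_ffun card_prod !card_ord card_Sn.
have -> : r + 2 * (d * k) = #|{: 'I_r + bool * ('I_d * 'I_k)}|.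
  by rewrite card_sum !card_prod card_bool !card_ord.
apply: (@leq_card_Gnd _ _ (@lift_rel r d k (adj E))).
- move=> s [u|[[] [i x]]] [v|[[] [j y]]] //=; exact: adj_sym.
- move=> s [u|[[] [i x]]] //=; apply/negbTE/negP => uu.
  by have /forall_inP/(_ _ uu) := sE; rewrite cards2 eqxx.
- move=> s [u|[[] [i x]]] /=.
  + rewrite -[RHS](eqP (rE u)) -[RHS](card_imset _ (@inl_inj _ (bool * ('I_d * 'I_k)))).
    congr #|pred_of_set _|; apply/setP => -[v|w].
      by rewrite inE mem_imset ?inE //; apply: inl_inj.
    by rewrite inE; apply/esym/negbTE/imsetP => -[].
  + have inj : injective (fun j => inr (false, (j, s (i, j) x)) : 'I_r + bool * ('I_d * 'I_k)).
      by move=> j j' [].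
    rewrite -[RHS]card_ord -[RHS](card_imset _ inj).
    congr #|pred_of_set _|; apply/setP => w; rewrite inE.
    apply/idP/imsetP => [|[j _ ->] /=]; last by rewrite eqxx.
    by case: w => [//|[[] [j y]]] //= /eqP <-; exists j.
  + have inj : injective
        (fun j => inr (true, (j, (s (j, i))^-1%g x)) : 'I_r + bool * ('I_d * 'I_k)).
      by move=> j j' [].
    rewrite -[RHS]card_ord -[RHS](card_imset _ inj).
    congr #|pred_of_set _|; apply/setP => w; rewrite inE.
    apply/idP/imsetP => [|[j _ ->] /=]; last by rewrite permKV eqxx.
    by case: w => [//|[[] [j y]]] //= /eqP <-; exists j; rewrite ?permK.
move=> s s' ss'; apply/ffunP => -[i j]; apply/permP => x.
by have := ss' (inr (true, (i, x))) (inr (false, (j, s (i, j) x))); rewrite /= eqxx => /esym/eqP.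
Qed.

(** Each factor of the falling factorial of [2 * k] is at least [k], and that factorial is
    ['C(2 * k, k) * k!] with the binomial at most [4 ^ k]. *)
Lemma expn_leq_fact k : k ^ k <= 4 ^ k * k`!.
Proof.
have h : k ^ k <= (2 * k) ^_ k.
  have -> : k ^ k = \prod_(i < k) k by rewrite prod_nat_const card_ord.
  rewrite ffact_prod.
  elim/big_ind2: _ => // [x x' y y'|i _]; first exact: leq_mul.
  by have := ltn_ord i; lia.
apply: leq_trans h _; rewrite -bin_ffact leq_mul2r; apply/orP; right.
apply: leq_trans (_ : \sum_(i < (2 * k).+1) 'C(2 * k, i) <= _).
  have k2 : k < (2 * k).+1 by lia.
  by rewrite (bigD1 (Ordinal k2)) //= leq_addr.
have := expnDn 1 1 (2 * k); rewrite (eq_bigr (fun i : 'I_ _ => 'C(2 * k, i))) => [<-|i _].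
  by rewrite expnM.
by rewrite !exp1n !muln1.
Qed.

(** In each residue class modulo [2 * d] take the least order of a [d]-regular graph, if any; [C] is
    the maximum over the finitely many classes. *)
Lemma Gnd_seeds d : exists C, forall n, 0 < d -> 0 < #|Gnd n d| ->
  exists r k, [/\ r <= C, n = r + 2 * (d * k) & 0 < #|Gnd r d|].
Proof.
pose P (i r : nat) := (r %% (2 * d) == i) && (0 < #|Gnd r d|).
have /boolp.choice[F hF] i : exists m, forall r, P i r -> P i m && (m <= r).
  have [[r Pr]|none] := boolp.EM (exists r, P i r).
    have ex : exists r, P i r by exists r.
    by case: (ex_minnP ex) => m Pm minm; exists m => r' /minm->; rewrite Pm.
  by exists 0 => r Pr; case: none; exists r.
exists (\max_(i < 2 * d) F i) => n d0 Gn.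
have ilt : n %% (2 * d) < 2 * d by rewrite ltn_mod muln_gt0.
have /hF/andP[/andP[/eqP Fmod GF] Fn] : P (n %% (2 * d)) n by rewrite /P eqxx.
set r := F _ in Fmod GF Fn; exists r, ((n - r) %/ (2 * d)); split=> //.
  exact: (leq_bigmax (Ordinal ilt)).
rewrite mulnA mulnC divnK ?subnKC //.
by rewrite -eqn_mod_dvd // Fmod.
Qed.

End ManyGraphs.

From mathcomp Require Import all_classical all_reals all_analysis ring lra.
Import Order.TTheory GRing.Theory Num.Theory.
Local Open Scope ring_scope.

(** * Distances and embeddings *)

Section GraphDistance.
Variables (V : finType) (E : {set {set V}}).
Implicit Types (u v : V) (k : nat).

Lemma gballP k u v : reflect (exists2 j, (j <= k)%N & walk E j u v) (v \in gball (adj E) k u).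
Proof.
apply: (iffP idP) => [|[j jk /existsP[p /andP[up /eqP <-]]]].
  elim: k v => [|k IH] v.
    rewrite inE => /eqP->; exists 0%N => //.
    by apply/existsP; exists [tuple]; rewrite /= eqxx.
  rewrite gballS => /nbhdP[/IH[j jk w]|[x /IH[j jk /existsP[p /andP[up /eqP xp]]] exv]].
    by exists j => //; apply: leqW.
  exists j.+1 => //; apply/existsP; exists (rcons_tuple p v).
  by rewrite rcons_path up xp exv last_rcons eqxx.
apply: (fintype.subsetP (leq_gball _ _ jk)).
have: size p = j by apply: size_tuple.
move: (tval p) up => /= {jk}s + <-; elim/last_ind: s => [|s x IH].
  by rewrite inE.
rewrite rcons_path last_rcons size_rcons => /andP[/IH us sx].
exact: nbhd_edge us sx.
Qed.

Lemma gdist_le k u v : v \in gball (adj E) k u -> (gdist E u v <= k)%N.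
Proof.
rewrite /gdist => /gballP[j jk w]; case: (leqP #|V| k) => Vk.
  by apply: leq_trans Vk; elim/big_rec: _ => // i x _ xV; rewrite geq_min xV orbT.
have jV := leq_ltn_trans jk Vk; apply: leq_trans jk.
have := mem_index_enum (Ordinal jV); elim: (index_enum _) => // i s IH.
rewrite inE big_cons => /orP[/eqP<-|/IH {}IH]; first by rewrite w geq_min leqnn.
by case: ifP => // _; rewrite geq_min IH orbT.
Qed.

(** The bound [k < #|V|] excludes the default value that [gdist] gives to unreachable pairs. *)
Lemma gdist_ball k u v : (k < #|V|)%N -> (gdist E u v <= k)%N -> v \in gball (adj E) k u.
Proof.
move=> kV; have [->|[j w ->]] : gdist E u v = #|V| \/ exists2 j, walk E j u v & gdist E u v = j.
- rewrite /gdist; elim/big_rec: _ => [|i x w IH]; first by left.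
  case/orP: (leq_total i x) => ix; last by rewrite (minn_idPr ix).
  by right; exists (i : nat); rewrite ?(minn_idPl ix).
- by rewrite leqNgt kV.
- by move=> jk; apply/gballP; exists j.
Qed.

Lemma gdist_gt0 u v : u != v -> (0 < gdist E u v)%N.
Proof.
move=> uv; rewrite lt0n; apply: contra uv => /eqP g0.
have V0 : (0 < #|V|)%N by apply/card_gt0P; exists u.
by have := @gdist_ball 0 u v V0; rewrite g0 inE eq_sym; apply.
Qed.

End GraphDistance.

Definition embeds (R : realType) (V T : finType) (rho : T -> T -> R) (D : R)
    (E : {set {set V}}) : Prop :=
  exists (f : V -> T) (s : R), 0 < s /\ forall u v,
    s * (gdist E u v)%:R <= rho (f u) (f v) <= s * D * (gdist E u v)%:R.

(** The threshold is the largest image distance over pairs at graph distance at most [r]. Being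
    attained, it is named by a pair of points of [T], which leaves finitely many choices; the
    two-sided bound on [f] then forces [gdist] at most [D * r]. *)
Lemma embeds_captured (R : realType) (V T : finType) (rho : T -> T -> R) D
    (E : {set {set V}}) r k :
    (0 < #|V|)%N -> 0 <= D -> D * r%:R < k.+1%:R -> (k < #|V|)%N -> embeds rho D E ->
  exists (f : V -> T) (i : T * T),
    captured (fun i x y => rho x y <= rho i.1 i.2) r k E f i.
Proof.
move=> /card_gt0P[v0 _] D0 Drk kV [f [s [s0 fP]]]; exists f.
pose near (x : V * V) := x.2 \in gball (adj E) r x.1.
have near0 : near (v0, v0) by apply: gball_center.
case: (arg_maxP (fun x : V * V => rho (f x.1) (f x.2)) near0) => -[x y] xy xymax.
exists (f x, f y); split=> [u v uv|u v /= uvxy]; first exact: (xymax (u, v)).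
apply: gdist_ball => //; rewrite -ltnS -(ltr_nat R); apply: le_lt_trans Drk.
rewrite -(ler_pM2l s0); apply: le_trans (_ : rho (f u) (f v) <= _).
  by case/andP: (fP u v).
apply: (le_trans uvxy); have /andP[_ h] := fP x y; apply: (le_trans h).
rewrite -mulrA ler_pM2l // ler_wpM2l // ler_nat.
exact: gdist_le.
Qed.

(** * Numerical estimates *)

Section Estimates.
Variable R : realType.
Implicit Types (d n N m k q : nat).

Lemma ln2_le1 : ln 2 <= 1 :> R.
Proof. by have := @le_ln1Dx R 1 ltac:(lra); rewrite (_ : 1 + 1 = 2 :> R) //; lra. Qed.

Lemma ln2_ge : 2^-1 <= ln 2 :> R.
Proof.
have := @le_ln1Dx R (- 2^-1) ltac:(lra).
have -> : 1 + - 2^-1 = 2^-1 :> R by lra.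
by rewrite lnV ?posrE //; lra.
Qed.

Lemma ln_natX n k : (0 < n)%N -> ln ((n ^ k)%:R : R) = k%:R * ln n%:R.
Proof. by move=> n0; rewrite natrX lnXn ?ltr0n // mulr_natl. Qed.

Lemma ln_natM m n : (0 < m)%N -> (0 < n)%N -> ln ((m * n)%:R : R) = ln m%:R + ln n%:R.
Proof. by move=> m0 n0; rewrite natrM lnM ?posrE ?ltr0n. Qed.

Lemma ler_ln_nat m n : (0 < m)%N -> (m <= n)%N -> ln (m%:R : R) <= ln n%:R.
Proof.
by move=> m0 mn; rewrite ler_ln ?posrE ?ltr0n ?ler_nat // (leq_trans m0).
Qed.

Lemma ln_nat_lt n : (0 < n)%N -> ln (n%:R : R) < n%:R.
Proof. by move=> n0; apply: ln_sublinear; rewrite ltr0n. Qed.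

(** The coefficient [9 / 8] is [1 + 1 / 16 + 1 / 16]: the partition, the partners of each vertex,
    and the edges at the exceptional set, with [q = 16 * d] in the decomposition. All other factors
    are exponential in [n]. *)
Lemma ln_captured_bound d n N m k a :
    (3 <= d)%N -> (0 < n)%N -> (0 < N)%N -> (N <= 2 ^ 2 ^ a)%N -> (2 ^ a <= n)%N ->
    (m * 2 ^ a <= n)%N -> k%:R * d%:R <= ln n%:R / (16 * d%:R) :> R ->
  ln (((m.+1 + n) ^ n * N ^ m.+1 * (N * N) * 2 ^ n *
       ((d.+1 ^ k).+1 ^ (d * n) * n.+1 ^ (d * (n %/ (16 * d)))))%:R : R)
    <= n%:R * (9 / 8 * ln n%:R + (9 + d%:R)).
Proof.
move=> d3 n0 N0 NA An mA kL.
have d0 : 0 < d%:R :> R by rewrite ltr0n; lia.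
have n1 : 1 <= n%:R :> R by rewrite ler1n.
have L0 : 0 <= ln n%:R :> R by apply: ln_ge0.
have h1 : ln ((m.+1 + n)%:R : R) <= ln n%:R + 2.
  apply: le_trans (_ : ln ((2 ^ 2 * n)%:R) <= _).
    apply: ler_ln_nat; first by lia.
    have : (m * 1 <= m * 2 ^ a)%N by rewrite leq_mul2l expn_gt0 orbT.
    by move: n0 mA; lia.
  by rewrite ln_natM // ln_natX //; have := ln2_le1; lra.
have lnN : ln (N%:R : R) <= (2 ^ a)%:R.
  apply: le_trans (ler_ln_nat N0 NA) _; rewrite ln_natX //.
  by rewrite ler_piMr ?ln2_le1.
have h2 : m.+1%:R * ln (N%:R : R) + (ln N%:R + ln N%:R) <= 4 * n%:R.
  have An' : (2 ^ a)%:R <= n%:R :> R by rewrite ler_nat.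
  have mA' : m%:R * (2 ^ a)%:R <= n%:R :> R by rewrite -natrM ler_nat.
  have : m%:R * ln (N%:R : R) <= m%:R * (2 ^ a)%:R by apply: ler_wpM2l.
  by rewrite -natr1; lra.
have h3 : ln ((d.+1 ^ k).+1%:R : R) <= ln n%:R / (16 * d%:R) + 1.
  apply: le_trans (_ : ln ((2 * d.+1 ^ k)%:R) <= _).
    by apply: ler_ln_nat => //; have := expn_gt0 d.+1 k; lia.
  rewrite ln_natM ?expn_gt0 // ln_natX //.
  have : k%:R * ln d.+1%:R <= k%:R * d%:R :> R.
    apply: ler_wpM2l => //; rewrite -nat1r.
    by apply: le_ln1Dx; lra.
  by have := ln2_le1; lra.
have h4 : ln (n.+1%:R : R) <= ln n%:R + 1.
  apply: le_trans (_ : ln ((2 * n)%:R) <= _); first by apply: ler_ln_nat; lia.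
  by rewrite ln_natM //; have := ln2_le1; lra.
have h5 : (d * (n %/ (16 * d)))%:R <= n%:R / 16 :> R.
  rewrite ler_pdivlMr // -natrM ler_nat.
  by apply: leq_trans (leq_trunc_div n (16 * d)); lia.
rewrite !ln_natM ?muln_gt0 ?expn_gt0 ?N0 // !ln_natX // !natrM.
have e1 : n%:R * ln (m.+1 + n)%:R <= n%:R * (ln n%:R + 2) :> R by apply: ler_wpM2l.
have e3 : d%:R * n%:R * ln (d.+1 ^ k).+1%:R <= n%:R * (ln n%:R / 16 + d%:R) :> R.
  have -> : n%:R * (ln n%:R / 16 + d%:R) = d%:R * n%:R * (ln n%:R / (16 * d%:R) + 1) :> R.
    by field; lra.
  by apply: ler_wpM2l => //; rewrite mulr_ge0.
have e4 : (d * (n %/ (16 * d)))%:R * ln n.+1%:R <= n%:R / 16 * (ln n%:R + 1) :> R.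
  by apply: ler_pM => //; apply: ln_ge0; rewrite ler1n.
have e2 : n%:R * ln 2 <= n%:R * 1 :> R by apply: ler_wpM2l => //; apply: ln2_le1.
rewrite natrM in e4; lra.
Qed.

(** As [r] is at most [n / 12], [d * k] is at least [11 / 24 * n]; a further factor [d >= 3] yields
    [11 / 8], which exceeds the [9 / 8] of the upper count. *)
Lemma ln_lift_bound d n r k :
    (3 <= d)%N -> (0 < n)%N -> n = (r + 2 * (d * k))%N -> (12 * r <= n)%N ->
    16 * d%:R <= ln n%:R :> R ->
  11 / 8 * n%:R * (ln n%:R - 16 * d%:R) <= ln ((k`! ^ (d * d))%:R : R).
Proof.
move=> d3 n0 nE rn dL.
have d0 : 0 < d%:R :> R by rewrite ltr0n; lia.
have nr : n%:R = r%:R + 2 * (d%:R * k%:R) :> R by rewrite {1}nE natrD !natrM.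
have rn' : 12 * r%:R <= n%:R :> R by rewrite -natrM ler_nat.
have dk : 11 / 24 * n%:R <= d%:R * k%:R :> R by lra.
have n1 : 1 <= n%:R :> R by rewrite ler1n.
have k0 : (0 < k)%N by case: k nE dk {nr} => // _; rewrite mulr0; lra.
have k0' : 0 < k%:R :> R by rewrite ltr0n.
have fk : k%:R * (ln k%:R - ln 4) <= ln (k`!%:R : R).
  have := ler_ln_nat _ (expn_leq_fact k); rewrite expn_gt0 k0 => /(_ isT).
  by rewrite ln_natM ?expn_gt0 ?fact_gt0 // !ln_natX //; lra.
have lk : ln n%:R - 16 * d%:R <= ln k%:R - ln 4 :> R.
  have h : (n <= (16 * d) * k)%N.
    rewrite -(ler_nat R) !natrM -[16 * _ * _]mulrA; lra.
  have : ln (n%:R : R) <= ln (16 * d)%:R + ln k%:R.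
    by rewrite -ln_natM //; [apply: ler_ln_nat | lia].
  have -> : (16 * d = 4 * (4 * d))%N by lia.
  rewrite !ln_natM //; try lia.
  have -> : ln 4%:R = ln (2 ^ 2)%:R :> R by [].
  rewrite ln_natX //.
  have := @ln_nat_lt d ltac:(lia); have := ln2_le1.
  have : 3 <= d%:R :> R by rewrite ler_nat.
  lra.
rewrite ln_natX ?fact_gt0 // natrM.
apply: le_trans (_ : d%:R * d%:R * (k%:R * (ln k%:R - ln 4)) <= _); last first.
  by apply: ler_wpM2l => //; rewrite mulr_ge0.
have -> : d%:R * d%:R * (k%:R * (ln k%:R - ln 4)) = d%:R * (d%:R * k%:R) * (ln k%:R - ln 4) :> R.
  by ring.
apply: ler_pM => //; [by lra|].
have : 3 * (11 / 24 * n%:R) <= d%:R * (d%:R * k%:R) :> R.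
  by apply: ler_pM => //; rewrite ler_nat.
lra.
Qed.

(** The iterated [up_log] is the exponent [a] with [N <= 2 ^ 2 ^ a]. Applying
    [up_log 2 x <= 1 + 2 * ln x] twice gives [5 + 2 * l], hence [7 * l]. *)
Lemma up_log_bound N : (3 <= N)%N -> 1 <= ln (ln N%:R) :> R ->
  (up_log 2 (up_log 2 N))%:R <= 7 * ln (ln N%:R) :> R.
Proof.
move=> N3 l1; set l := ln (ln N%:R); set L := up_log 2 N.
have Lgt1 : (1 < L)%N.
  rewrite ltnNge; apply/negP => /(leq_pexp2l (isT : (0 < 2)%N)); rewrite expn1 leqNgt.
  by rewrite (leq_trans N3) // up_logP.
have upper x : (1 < x)%N -> (up_log 2 x)%:R <= 1 + 2 * ln x%:R :> R.
  move=> x1; have := up_log_gtn (isT : (1 < 2)%N) x1.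
  have : (0 < up_log 2 x)%N by rewrite up_log_gt0.
  case: (up_log 2 x) => // j _ /= jx.
  have := ler_ln_nat _ (ltnW jx); rewrite expn_gt0 => /(_ isT).
  rewrite ln_natX // => h.
  have : j%:R * 2^-1 <= j%:R * ln 2 :> R by apply: ler_wpM2l => //; apply: ln2_ge.
  by rewrite -[j.+1%:R]natr1; lra.
have N1 : 1 <= ln N%:R :> R.
  have [//|lt1] := leP 1 (ln N%:R : R).
  have [pos|neg] := ltP 0 (ln N%:R : R); last by move: l1; rewrite ln0 //; lra.
  by have := ln_sublinear pos; lra.
have hL : L%:R <= 3 * ln N%:R :> R by have := upper N ltac:(lia); rewrite -/L; lra.
have hl : ln (L%:R : R) <= 2 + l.
  apply: le_trans (_ : ln (3 * ln N%:R) <= _).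
    by rewrite ler_ln ?posrE ?ltr0n //; [lia | lra].
  rewrite lnM ?posrE //; last lra.
  by rewrite -/l; have := @le_ln1Dx R 2 ltac:(lra); rewrite (_ : 1 + 2 = 3 :> R); lra.
have := upper L Lgt1; rewrite -/l in l1 *; lra.
Qed.

End Estimates.

(** * Comparison of the two counts *)

Section FewEmbeddings.
Variable R : realType.

Lemma embeds_leq_card (V T : finType) (rho : T -> T -> R) D (E : {set {set V}}) :
  (forall x, rho x x = 0) -> embeds rho D E -> (#|V| <= #|T|)%N.
Proof.
move=> rho0 [f [s [s0 fP]]]; apply: (leq_card f) => u v fuv.
apply/eqP; apply: contraT => uv; have /andP[+ _] := fP u v.
rewrite fuv rho0 leNgt; case/negP; apply: mulr_gt0 => //.
by rewrite ltr0n gdist_gt0.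
Qed.

Lemma embeds_ge1 (V T : finType) (rho : T -> T -> R) D (E : {set {set V}}) :
  (1 < #|V|)%N -> embeds rho D E -> 1 <= D.
Proof.
move=> /card_gt1P[u [v [_ _ uv]]] [f [s [s0 fP]]].
have /andP[h1 h2] := fP u v; have := le_trans h1 h2.
by rewrite -mulrA ler_pM2l // ler_pMl // ltr0n gdist_gt0.
Qed.

(** If the minimum were [L], then [D = c < 1]. So it is [l], and [1 <= D] reads [l <= c * L]. *)
Lemma distortion_range (d L l c D : R) :
    3 <= d -> 200 * d <= L -> 1 <= l -> c * (400 * 400 * d ^+ 3) = 1 ->
    D = c * (L / Num.min L l) -> 1 <= D ->
  l <= c * L /\ D * l = c * L.
Proof.
move=> d3 dL l1 cE ->.
have d27 : 27 <= d ^+ 3.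
  rewrite exprS expr2; have : 9 <= d * d by nra.
  nra.
have c1 : c < 1 by nra.
have c0 : 0 < c by nra.
rewrite minEle; case: ifP => _.
  by rewrite divff ?gt_eqF //; lra.
rewrite mulrA ler_pdivlMr ?mul1r => [h|]; last lra.
by split=> //; rewrite divfK // gt_eqF //; lra.
Qed.

(** Here [s] is the covering radius of the net and [D * (s + s + 1)] bounds how far apart captured
    net points can be. The choice of [c] keeps the radius [s + s + D * (s + s + 1)] a small multiple
    of [L]. *)
Lemma radius_estimates (d L l c D a s : R) :
    3 <= d -> 0 < L -> 1 <= l -> c * (400 * 400 * d ^+ 3) = 1 -> 0 <= D ->
    l <= c * L -> D * l = c * L -> a <= 7 * l -> s = 4 * (16 * d * a) + 1 ->
  [/\ a <= L, D * (s + s + 1) < L &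
      (s + s + D * (s + s + 1)) * d <= L / (16 * d)].
Proof.
move=> d3 L0 l1 cE D0 lL DE al sE.
have d0 : 0 < d by lra.
have cL0 : 0 < c * L by lra.
have c0 : 0 < c by rewrite -(pmulr_lgt0 _ L0).
(* All quantities are compared with [y], made opaque so that its products with powers of [d] are
   atoms for linear arithmetic. *)
pose y := d * c * L.
have y_def : y = d * c * L by [].
clearbody y.
have ydd : 400 * (400 * (y * d * d)) = L.
  transitivity (c * (400 * 400 * d ^+ 3) * L); last by rewrite cE mul1r.
  by rewrite y_def; ring.
have y0 : 0 < y by rewrite y_def -mulrA mulr_gt0.
have yd : 3 * y <= y * d by rewrite mulrC ler_pM2l.
have yd' : 3 * (y * d) <= y * d * d by rewrite mulrC ler_pM2l // mulr_gt0.
have cy : 3 * (c * L) <= y by rewrite y_def -mulrA ler_pM2r.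
have dl : d * l <= y by rewrite y_def -mulrA ler_pM2l.
have dl3 : 3 <= d * l by rewrite -[3]mulr1 ler_pM.
have da : d * a <= d * (7 * l) by rewrite ler_pM2l.
have sl : s <= 449 * (d * l) by lra.
have Ds : D * (s + s + 1) <= 899 * y.
  apply: le_trans (_ : D * (899 * (d * l)) <= _); first by apply: ler_wpM2l => //; lra.
  have -> : D * (899 * (d * l)) = 899 * d * (D * l) by ring.
  by rewrite DE y_def; lra.
split; [lra|lra|].
rewrite ler_pdivlMr; last lra.
have : (s + s + D * (s + s + 1)) * (d * d) <= (1797 * y) * (d * d).
  by rewrite ler_pM2r ?mulr_gt0 //; lra.
lra.
Qed.

(** The logarithms of the two counts differ by about [n * ln n / 4], which absorbs the terms linear
    in [n] and the extra factor [n]. *)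
Lemma few_embeddings d r k n N (rho : 'I_N -> 'I_N -> R) c D :
    (3 <= d)%N -> (3 <= N)%N -> (forall x, rho x x = 0) ->
    c * (400 * 400 * d%:R ^+ 3) = 1 ->
    D = c * (ln n%:R / Num.min (ln n%:R) (ln (ln N%:R))) ->
    n = (r + 2 * (d * k))%N -> (12 * r <= n)%N -> (0 < #|Gnd r d|)%N ->
    200 * d%:R <= ln n%:R :> R ->
  (n * #|[set E in Gnd n d | `[< embeds rho D E >]]%SET| <= #|Gnd n d|)%N.
Proof.
move=> d3 N3 rho0 cE DE nE rn Gr dL; set B := finset _.
have [->|[E0 E0B]] := finset.set_0Vmem B; first by rewrite finset.cards0 muln0.
have d3' : 3 <= d%:R :> R by rewrite ler_nat.
have n0 : (0 < n)%N.
  rewrite lt0n; apply/eqP => n0; move: dL; rewrite n0 ln0 // => dL.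
  by clear -d3' dL; lra.
have Ln : ln n%:R < n%:R :> R by apply: ln_nat_lt.
have n20 : 20 <= n%:R :> R by clear -Ln d3' dL; lra.
have n1 : (1 < n)%N by apply: leq_trans (_ : (20 <= n)%N) => //; rewrite -(ler_nat R).
have embE0 : embeds rho D E0 by move: E0B; rewrite inE => /andP[_ /asboolP].
have D1 : 1 <= D by apply: embeds_ge1 embE0; rewrite card_ord.
have nN : (n <= N)%N by have := embeds_leq_card rho0 embE0; rewrite !card_ord.
have LN : ln n%:R <= ln N%:R :> R by apply: ler_ln_nat.
(* An embedding is injective, so [n <= N], and the size of [n] makes [ln (ln N)] at least 1. *)
have l1 : 1 <= ln (ln N%:R) :> R.
  have N4 : 4 <= ln N%:R :> R by clear -LN dL d3'; lra.
  have : ln (2 ^ 2)%:R <= ln (ln N%:R) :> R.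
    by rewrite ler_ln ?posrE ?ltr0n //; clear -N4; lra.
  by rewrite ln_natX //; have := ln2_ge R; clear; lra.
have [lL DlE] := distortion_range d3' dL l1 cE DE D1.
have D0 : 0 <= D by apply: le_trans D1.
have L0 : 0 < ln n%:R :> R by clear -dL d3'; lra.
set a := up_log 2 (up_log 2 N).
set t := (16 * d * a)%N; set s := (4 * t + 1)%N.
have sE : s%:R = 4 * (16 * d%:R * a%:R) + 1 :> R by rewrite natrD !natrM.
have [aL Ds sD] := radius_estimates d3' L0 l1 cE D0 lL DlE (up_log_bound N3 l1) sE.
have rE : (s + s + 1)%:R = s%:R + s%:R + 1 :> R by rewrite !natrD.
(* Graph distances are integers, so the bound [D * (s + s + 1)] may be replaced by its floor. *)
rewrite -rE in Ds sD; pose k' := Num.truncn (D * (s + s + 1)%:R).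
have /truncn_itv/andP[k'le k'gt] : 0 <= D * (s + s + 1)%:R by rewrite mulr_ge0.
have k'n : (k' < n)%N.
  by rewrite -(ltr_nat R); apply: le_lt_trans k'le (lt_trans Ds Ln).
have an : (2 ^ a <= n)%N.
  rewrite -(ler_nat R) -ler_ln ?posrE ?ltr0n ?expn_gt0 // ln_natX //.
  by apply: le_trans aL; rewrite ler_piMr // ln2_le1.
have K : (s + s + k')%:R * d%:R <= ln n%:R / (16 * d%:R) :> R.
  apply: le_trans sD; apply: ler_wpM2r => //.
  by rewrite [in leLHS]natrD [in leLHS]natrD lerD2l.
have NA : (N <= 2 ^ 2 ^ a)%N.
  apply: leq_trans (up_logP N (isT : (1 < 2)%N)) _.
  by rewrite leq_exp2l // up_logP.
have B0 : (0 < #|B|)%N by apply/card_gt0P; exists E0.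
have d16 : (0 < 16 * d)%N by rewrite muln_gt0 (leq_trans _ d3).
have V0 : (0 < #|'I_n|)%N by rewrite card_ord.
pose Q (i : 'I_N * 'I_N) : rel 'I_N := fun x y => rho x y <= rho i.1 i.2.
have hB E : E \in B -> [/\ simple E, regular d E &
    exists (f : 'I_n -> 'I_N) i, captured Q (s + s + 1) k' E f i].
  rewrite !inE => /andP[/andP[sE' rE'] /asboolP embE]; split=> //.
  by apply: (embeds_captured V0 D0 _ _ embE); rewrite ?card_ord.
have cB := @card_captured _ _ _ Q d (16 * d)%N a k' B d16 V0 hB.
rewrite !card_prod !card_ord -/t -/s in cB.
have up : ln #|B|%:R <= n%:R * (9 / 8 * ln n%:R + (9 + d%:R)) :> R.
  apply: le_trans (ler_ln_nat R B0 cB) _.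
  apply: (ln_captured_bound d3 n0 _ NA an _ K); last exact: leq_trunc_div.
  exact: leq_trans N3.
have low : 11 / 8 * n%:R * (ln n%:R - 16 * d%:R) <= ln #|Gnd n d|%:R :> R.
  apply: le_trans (ln_lift_bound d3 n0 nE rn _) _; first by clear -dL d3'; lra.
  by apply: ler_ln_nat; rewrite ?expn_gt0 ?fact_gt0 // nE card_Gnd_lift.
have G0 : (0 < #|Gnd n d|)%N.
  by rewrite nE; apply: leq_trans (card_Gnd_lift k Gr); rewrite expn_gt0 fact_gt0.
rewrite -(ler_nat R) -ler_ln ?posrE ?ltr0n ?muln_gt0 ?n0 // ln_natM //.
apply: le_trans low; apply: le_trans (lerD (lexx _) up) _.
have h1 : n%:R * (200 * d%:R) <= n%:R * ln n%:R :> R by rewrite ler_pM2l ?ltr0n.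
have h2 : 20 * ln n%:R <= n%:R * ln n%:R :> R by rewrite ler_pM2r.
have h3 : n%:R * 3 <= n%:R * d%:R :> R by rewrite ler_pM2l ?ltr0n.
have h0 : 0 <= n%:R :> R by []; clear -h0 h1 h2 h3; lra.
Qed.

End FewEmbeddings.

(** * From counting to the probability bound *)

Lemma card_II_enum (M : Type) N : ([set: M] #= `I_N)%classic%card ->
  exists g : 'I_N -> M, forall x, exists i, g i = x.
Proof.
case/card_set_bijP => f [fN finj fsurj].
have /choice[g gP] : forall i : 'I_N, exists x, f x = i.
  by move=> i; have [x _ <-] := fsurj i (ltn_ord i); exists x.
exists g => x; have xN : (f x < N)%N := fN x I.
by exists (Ordinal xN); apply: finj; rewrite ?inE // gP.
Qed.

(** An admissible constant below [D] would come with a map into [M]; lifting it through [g] would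
    embed [E] with constant [D]. *)
Lemma graph_distortion_ge (R : realType) n (E : {set {set 'I_n}}) N
    (M : metricType R) (g : 'I_N -> M) D :
    (forall x, exists i, g i = x) ->
    ~ embeds (fun i j => mdist (g i) (g j)) D E ->
  (D%:E <= graph_distortion E M)%E.
Proof.
move=> gsurj notE; apply: le_ereal_inf_tmp => _ [D' [D'0 [f [s [s0 fP]]]] <-].
rewrite lee_fin leNgt; apply/negP => D'D; apply: notE.
have /choice[h hP] : forall u, exists i, g i = f u by move=> u; apply: gsurj.
exists h, s; split=> // u v; rewrite !hP.
have /andP[-> /le_trans -> //] := fP u v.
by rewrite ler_wpM2r // ler_pM2l // ltW.
Qed.

Lemma prob_Gnd_ge (R : realType) n d (A : set {set {set 'I_n}}) (B : {set {set {set 'I_n}}}) :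
    (0 < n)%N -> (0 < #|Gnd n d|)%N -> (n * #|B| <= #|Gnd n d|)%N ->
    (forall E, E \in Gnd n d -> ~ A E -> E \in B) ->
  1 - n%:R^-1 <= prob_Gnd R d A.
Proof.
move=> n0 G0 nB AB; rewrite /prob_Gnd ler_pdivlMr ?ltr0n // mulrBl mul1r lerBlDr.
set A' := finset _.
have GAB : (#|Gnd n d| <= #|A'| + #|B|)%N.
  apply: leq_trans (leq_card_setU A' B); apply/subset_leq_card/fintype.subsetP => E EG.
  rewrite !inE; rewrite inE in EG; rewrite EG.
  have [//|/asboolPn nA] := boolP `[< A E >].
  by rewrite AB ?orbT // inE.
apply: le_trans (_ : (#|A'| + #|B|)%:R <= _); first by rewrite ler_nat.
by rewrite natrD lerD2l ler_pdivlMl ?ltr0n // -natrM ler_nat.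
Qed.

Theorem corollary1p8 (R : realType) (d : nat) (hd : (3 <= d)%N) :
  exists c tau B : R, [/\ 0 < c, 0 < tau, 0 < B &
    forall (N : nat) (M : metricType R),
      (3 <= N)%N -> ([set: M] #= `I_N)%classic%card ->
    forall n : nat,
      (d <= n)%N -> ~~ odd (d * n) -> (0 < #|Gnd n d|)%N ->
      1 - B / n%:R `^ tau <=
      @prob_Gnd R n d (fun E =>
        ((c * (ln n%:R / Num.min (ln n%:R) (ln (ln N%:R))))%:E
           <= graph_distortion E M)%E)].
Proof.
have [C seeds] := Gnd_seeds d.
have d0 : (0 < d)%N by apply: leq_trans hd.
have [c c0 cE] : exists2 c : R, 0 < c & c * (400 * 400 * d%:R ^+ 3) = 1.
  have: 0 < 400 * 400 * d%:R ^+ 3 :> R.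
    by apply: mulr_gt0; [apply: mulr_gt0; rewrite ltr0n | apply: exprn_gt0; rewrite ltr0n].
  move: (_ * _ ^+ 3) => x x0; exists x^-1; first by rewrite invr_gt0.
  by rewrite mulVf // gt_eqF.
(* For [n < B] the claimed lower bound is negative. For larger [n] the two summands provide
   [200 * d <= ln n] and [12 * r <= n]. *)
pose B : R := expR (200 * d%:R) + (12 * C)%:R.
have B1 : 1 <= B.
  by rewrite /B -[leLHS]addr0 lerD // -expR0 ler_expR mulr_ge0.
exists c, 1, B; split=> // [|N M N3 cardM n dn _ G0]; first exact: lt_le_trans B1.
have n0 : (0 < n)%N by apply: leq_trans dn.
rewrite powRr1 //; have [nB|Bn] := ltP n%:R B.
  apply: le_trans (_ : 0 <= _); last by rewrite divr_ge0.
  by rewrite subr_le0 ler_pdivlMr ?ltr0n // mul1r ltW.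
have [r [k [rC nE Gr]]] := seeds n d0 G0.
have dL : 200 * d%:R <= ln n%:R :> R.
  rewrite -[leLHS]expRK ler_ln ?posrE ?expR_gt0 ?ltr0n //.
  by apply: le_trans Bn; rewrite lerDl.
have rn : (12 * r <= n)%N.
  apply: leq_trans (_ : 12 * C <= _)%N; first by rewrite leq_mul2l rC orbT.
  by rewrite -(ler_nat R); apply: le_trans Bn; rewrite lerDr expR_ge0.
have [g gsurj] := card_II_enum cardM.
have few := few_embeddings (rho := fun i j => mdist (g i) (g j)) hd N3
  (fun i => mdistxx (g i)) cE erefl nE rn Gr dL.
apply: (@le_trans _ _ (1 - n%:R^-1)).
  by rewrite lerD2l lerN2 -[leLHS]mul1r ler_pM2r // invr_gt0 ltr0n.
have := @prob_Gnd_ge R n d _ _ n0 G0 few; apply => E EG notA.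
rewrite !inE; rewrite inE in EG; rewrite EG /=; apply/asboolP.
by apply: contrapT => /(graph_distortion_ge gsurj)/notA.
Qed.
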